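(* Let $(\Phi,\Delta)$ be an infinite based root system in $(V,B)$ with associated Coxeter system $(W,S)$ and with $\Delta$ a basis of $V$. Then: (i) Let $\rho\in\Phi$ and $x\in D\cap Q$, and let $L(\widehat\rho,x)$ be the line containing $\widehat\rho$ and $x$. (a) If $B(\rho,x)=0$, then $L(\widehat\rho,x)$ intersects $Q$ only in $x$, and $s_\rho\cdot x=x$. (b) If $B(\rho,x)\neq0$, then $L(\widehat\rho,x)$ intersects $Q$ in the two distinct points $x$ and $s_\rho\cdot x$. (ii) Let $\rho_1\neq\rho_2\in\Phi$, $x\in L(\widehat{\rho_1},\widehat{\rho_2})\cap Q$ and $w\in W$. Then $w\cdot x\in L(w\cdot\widehat{\rho_1},w\cdot\widehat{\rho_2})\cap Q$.
   Context: Let $V$ be a finite-dimensional real vector space with a symmetric bilinear form $B$. For $\alpha\in V$ with $B(\alpha,\alpha)\neq 0$, let $s_\alpha(v)=v-2\frac{B(\alpha,v)}{B(\alpha,\alpha)}\alpha$ for $v\in V$. A simple system is a finite subset $\Delta\subset V$ such that: (1) $\Delta$ is positively independent (if $\sum_{\alpha\in\Delta}\lambda_\alpha\alpha=0$ with all $\lambda_\alpha\ge 0$ then all $\lambda_\alpha=0$); (2) for distinct $\alpha,\beta\in\Delta$, $B(\alpha,\beta)\in(-\infty,-1]\cup\{-\cos(\pi/k): k\in\mathbb{Z}_{\ge 2}\}$; (3) $B(\alpha,\alpha)=1$ for all $\alpha\in\Delta$. Let $W$ be the subgroup of the orthogonal group $O_B(V)$ generated by $S=\{s_\alpha:\alpha\in\Delta\}$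 and $\Phi=W(\Delta)$ the orbit of $\Delta$. The pair $(\Phi,\Delta)$ is called a based root system in $(V,B)$; $(W,S)$ is a Coxeter system, and $s_\rho\in W$ for every $\rho\in\Phi$. Let $\mathrm{cone}(\Delta)$ be the set of nonnegative linear combinations of $\Delta$ and $\Phi^+=\Phi\cap\mathrm{cone}(\Delta)$; then $\Phi=\Phi^+\sqcup(-\Phi^+)$. Standing assumptions: $\Delta$ is a basis of $V$ and $\Phi$ is infinite. For $v=\sum_{\alpha\in\Delta}v_\alpha\alpha$ put $|v|_1=\sum_{\alpha\in\Delta}v_\alpha$, $V_0=\{v:|v|_1=0\}$, $V_1=\{v:|v|_1=1\}$. For $v\in V\setminus V_0$ put $\widehat v=v/|v|_1\in V_1$. One has $\Phi\cap V_0=\emptyset$; put $\widehat\Phi=\{\widehat\rho:\rho\in\Phi\}$, and let $E$ be the set of limits of convergent injective sequences of elements of $\widehat\Phi$. Put $q(v)=B(v,v)$ and $Q=\{v\in V:q(v)=0\}$. The set $D=V_1\setminus\bigcup_{w\in W}w(V_0)$ carries an action of $W$ given by $w\cdot x=\widehat{w(x)}$; both $\widehat\Phi$ and $E$ are contained in $D$ and stable under this action, and $w\cdot\widehat\rho=\widehat{w(\rho)}$ for $\rho\in\Phi$. Every point of $L(\widehat{\rho_1},\widehat{\rho_2})\cap Q$ with $\rho_1,\rho_2\in\Phi$ belongs to $E\subseteq D$, so the action is defined on it. For points $x,y$, $L(x,y)=\{\lambda x+(1-\lambda)y:\lambda\in\mathbb R\}$ is the line through $x$ and $y$ (reduced to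 a point if $x=y$). *)

(* Defs.v *)
From HB Require Import structures.
From mathcomp Require Import all_boot all_order all_algebra.
From mathcomp Require Import finmap.
From mathcomp Require Import boolp classical_sets functions cardinality.
From mathcomp Require Import reals trigo.
From mathcomp Require Import ring.

Set Implicit Arguments.
Unset Strict Implicit.
Unset Printing Implicit Defensive.

Import Order.TTheory GRing.Theory Num.Theory.

Local Open Scope classical_set_scope.
Local Open Scope ring_scope.

Section BasedRootSystems.
Variables (R : realType) (V : vectType R) (B : {symmetric V}).

Lemma formC (u v : V) : B u v = B v u.
Proof. by rewrite hermC expr0 mul1r. Qed.

Definition reflection_fun (a v : V) : V := v - (2 * (B a v / B a a)) *: a.

Lemma reflection_fun_linear a : linear (reflection_fun a).
Proof.
move=> k u v; rewrite /reflection_fun linearDr linearZr /=.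
rewrite scalerBr scalerA addrACA -opprD -scalerDl; congr (_ - _ *: _).
by ring.
Qed.

HB.instance Definition _ a :=
  GRing.isLinear.Build R V V _ (reflection_fun a) (reflection_fun_linear a).

(* When [B a a = 0] this is the identity, since [x / 0 = 0]. *)
Definition reflection (a : V) : 'End(V) := linfun (reflection_fun a).

Lemma reflectionE a v : reflection a v = v - (2 * (B a v / B a a)) *: a.
Proof. by rewrite lfunE. Qed.

(* The form may be degenerate, so invertibility has to be required. *)
Definition orthogonal_group : set 'End(V) :=
  [set f | lker f == 0%VS /\ forall u v, B (f u) (f v) = B u v].

Definition orthogonal_subgroup (G : set 'End(V)) : Prop :=
  [/\ G `<=` orthogonal_group, G \1%VF,
      forall f g, G f -> G g -> G (f \o g)%VF
    & forall f, G f -> G (f^-1)%VF].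

Lemma reflection_orthogonal a : B a a != 0 -> orthogonal_group (reflection a).
Proof.
move=> a0.
have isoB u v : B (reflection a u) (reflection a v) = B u v.
  rewrite !reflectionE linearBr !linearBl /= !linearZr !linearZl /=.
  by rewrite (formC u a); field.
have invo v : reflection a (reflection a v) = v.
  rewrite !reflectionE linearBr linearZr /= -addrA -opprD -scalerDl.
  rewrite [X in X *: a](_ : _ = 0); last by field.
  by rewrite scale0r subr0.
split=> //; apply/lker0P => u v uv.
by rewrite -(invo u) uv invo.
Qed.

Definition positively_independent (Delta : {fset V}) : Prop :=
  forall lambda : V -> R,
    {in Delta, forall a, 0 <= lambda a} ->
    \sum_(a <- Delta) lambda a *: a = 0 ->
    {in Delta, forall a, lambda a = 0}.

Definition simple_system (Delta : {fset V}) : Prop :=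
  [/\ positively_independent Delta,
      {in Delta &, forall a b, a != b ->
         B a b <= -1 \/ exists2 k : nat, (2 <= k)%N & B a b = - cos (pi / k%:R)}
    & {in Delta, forall a, B a a = 1}].

Definition simple_reflections (Delta : {fset V}) : set 'End(V) :=
  [set reflection a | a in [set` Delta]].

Definition reflection_group (Delta : {fset V}) : set 'End(V) :=
  smallest orthogonal_subgroup (simple_reflections Delta).

Definition based_root_system (Phi : set V) (Delta : {fset V}) : Prop :=
  simple_system Delta /\
  Phi = [set w a | w in reflection_group Delta & a in [set` Delta]].

Definition isotropic_cone : set V := [set v | B v v = 0].

Definition line (x y : V) : set V := [set l *: x + (1 - l) *: y | l in setT].

(* The sum of the coordinates of [v] in [Delta], meaningful when [Delta] is a
   basis of [V]. *)
Definition norm1 (Delta : {fset V}) (v : V) : R :=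
  \sum_i coord (in_tuple Delta) i v.

Definition V0 (Delta : {fset V}) : set V := [set v | norm1 Delta v = 0].
Definition V1 (Delta : {fset V}) : set V := [set v | norm1 Delta v = 1].

(* Off its domain, i.e. when [norm1 Delta v = 0], this is [0], which is not in
   [V1 Delta]. *)
Definition normalize (Delta : {fset V}) (v : V) : V := (norm1 Delta v)^-1 *: v.

Definition action_domain (Delta : {fset V}) : set V :=
  V1 Delta `\` \bigcup_(w in reflection_group Delta) (w @` V0 Delta).

Definition act (Delta : {fset V}) (w : 'End(V)) (x : V) : V :=
  normalize Delta (w x).

End BasedRootSystems.

(* Main.v *)
Require Import Defs.
From HB Require Import structures.
From mathcomp Require Import all_boot all_order all_algebra.
From mathcomp Require Import finmap.
From mathcomp Require Import boolp classical_sets functions cardinality.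
From mathcomp Require Import reals trigo.
From mathcomp Require Import ring lra zify.

(** Once every normalization in sight is known to be defined, both claims are
    short computations. With [n] the coordinate sum of [rho], the form at the
    point of parameter [l] of the line through [rho / n] and an isotropic [x]
    is [l / n * (l / n + 2 * (1 - l) * B rho x)]; besides [l = 0], which is
    [x], its other zero is the normalization of the reflection of [x]. The
    second claim says that the projective action of a linear map sends lines
    to lines.

    The substance is that the coordinate sum vanishes neither on the roots nor
    on the isotropic vectors spanned by two roots. A nonzero vector has nonzero
    coordinate sum as soon as its coordinates have constant sign ([signed],
    [norm1_signed]), so it is enough to prove two sign statements.

    Every root is [signed] ([root_sign]). The argument is the classical one for
    Coxeter groups: if a word [s] in the simple reflections is shortest in the
    group and appending [a] does not shorten it, then [s] sends [a] to a
    nonnegative vector ([ascent_nonneg]). The induction splits off from [s] a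
    maximal tail in two simple reflections, where the coefficients of roots are
    Chebyshev polynomials ([alt_root]); they are nonnegative when the form
    is at most [-1] on the two simple roots, and when it is [- cos (pi / m)]
    they are nonnegative up to length [m - 1], which is as long as the braid
    relation allows the tail to be.

    Every isotropic vector [y] in the plane of two roots is [signed]
    ([isotropic_signed]). Up to scaling, the dihedral group of the two roots
    produces roots [r + c *: y] with a fixed root [r] and with [c] arbitrarily
    large ([roots_near_isotropic]). If [y] had coordinates of both signs, such
    a root would too. The image of [y] under a group element is again isotropic
    in the plane of two roots, so its coordinate sum does not vanish either. *)

Set Implicit Arguments.
Unset Strict Implicit.
Unset Printing Implicit Defensive.

Import Order.TTheory GRing.Theory Num.Theory.

Local Open Scope classical_set_scope.
Local Open Scope ring_scope.

(** * Chebyshev coefficients *)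

(** [cheb k n.+1] is the Chebyshev polynomial of the second kind of degree [n]
    at [k]. *)
Definition cheb (R : realType) (k : R) (n : nat) : R :=
  (iter n (fun p : R * R => (p.2, 2 * k * p.2 - p.1)) (0, 1)).1.

Lemma chebSS (R : realType) (k : R) n :
  cheb k n.+2 = 2 * k * cheb k n.+1 - cheb k n.
Proof. by []. Qed.

Lemma cheb_ge0 (R : realType) (k : R) n : 1 <= k -> 0 <= cheb k n.
Proof.
move=> k1; suff: 0 <= cheb k n <= cheb k n.+1 by case/andP.
elim: n => [|n /andP[c0 c1]]; first by rewrite /cheb /= ler01 lexx.
have c1' : 0 <= cheb k n.+1 by apply: le_trans c1.
rewrite c1' chebSS /=; nra.
Qed.

Lemma cheb_cos (R : realType) (t : R) n :
  cheb (cos t) n * sin t = sin (n%:R * t).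
Proof.
suff [] : cheb (cos t) n * sin t = sin (n%:R * t) /\
          cheb (cos t) n.+1 * sin t = sin (n.+1%:R * t) by [].
elim: n => [|n [IH0 IH1]]; first by rewrite /cheb /= !mul0r sin0 !mul1r.
split=> //; rewrite chebSS mulrBl -(mulrA (2 * _)) IH1 IH0.
have -> : n.+2%:R * t = n.+1%:R * t + t by rewrite -[n.+2]addn1 natrD; ring.
have -> : n%:R * t = n.+1%:R * t - t by rewrite -[n.+1]addn1 natrD; ring.
by rewrite sinB sinD; ring.
Qed.

Lemma sin_pi_div_gt0 (R : realType) (m : nat) :
  (2 <= m)%N -> 0 < sin (pi / m%:R : R).
Proof.
move=> m2; have m0 : (0 : R) < m%:R by rewrite ltr0n; lia.
apply: sin_gt0_pi; rewrite divr_gt0 ?pi_gt0 //=.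
by rewrite ltr_pdivrMr // ltr_pMr ?pi_gt0 // ltr1n.
Qed.

Lemma cheb_cos_pi_ge0 (R : realType) (m n : nat) :
  (2 <= m)%N -> (n <= m)%N -> 0 <= cheb (cos (pi / m%:R : R)) n.
Proof.
move=> m2 nm; have m0 : (0 : R) < m%:R by rewrite ltr0n; lia.
rewrite -(pmulr_lge0 _ (sin_pi_div_gt0 R m2)) cheb_cos sin_ge0_pi //.
rewrite mulr_ge0 ?ler0n ?divr_ge0 ?pi_ge0 ?ler0n //=.
by rewrite mulrCA ler_piMr ?pi_ge0 // ler_pdivrMr // mul1r ler_nat.
Qed.

Lemma cheb_cos_pi (R : realType) (m : nat) (c := cheb (cos (pi / m%:R : R))) :
  (2 <= m)%N -> [/\ c m = 0, c m.+1 = -1 & c m.-1 = 1].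
Proof.
move=> m2; have m0 : m%:R != 0 :> R by rewrite pnatr_eq0; lia.
have s0 := lt0r_neq0 (sin_pi_div_gt0 R m2).
have cm : c m = 0.
  by apply: (mulIf s0); rewrite cheb_cos mul0r mulrCA divff // mulr1 sinpi.
have cm1 : c m.+1 = -1.
  apply: (mulIf s0); rewrite cheb_cos -[m.+1]addn1 natrD mulrDl mul1r.
  by rewrite mulrCA divff // mulr1 addrC sinDpi mulN1r.
split=> //; have := chebSS (cos (pi / m%:R : R)) m.-1.
rewrite -/c prednK; last by lia.
by rewrite cm cm1 mulr0 sub0r => /oppr_inj.
Qed.

(** * Words of reflections *)

Section Words.
Variables (R : realType) (V : vectType R) (B : {symmetric V}).

Implicit Types (a b v : V) (s t : seq V).

Lemma reflection_unitE a v :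
  B a a = 1 -> reflection B a v = v - (2 * B a v) *: a.
Proof. by move=> a1; rewrite reflectionE a1 divr1. Qed.

Lemma reflection_self a : B a a = 1 -> reflection B a a = - a.
Proof.
by move=> a1; rewrite reflection_unitE // a1 mulr1 scaler_nat mulr2n opprD addrA
  subrr sub0r.
Qed.

Lemma reflectionK a : B a a = 1 -> involutive (reflection B a).
Proof.
move=> a1 v; rewrite (reflection_unitE v) // linearB linearZ /=.
by rewrite reflection_self // reflection_unitE // scalerN opprK addrNK.
Qed.

Lemma reflection_form a u v :
  B a a = 1 -> B (reflection B a u) (reflection B a v) = B u v.
Proof.
by move=> a1; case: (@reflection_orthogonal _ _ B a); rewrite ?a1 ?oner_neq0.
Qed.

Definition word_act s v : V := foldr (fun a => reflection B a : V -> V) v s.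

Lemma word_act_cons a s v :
  word_act (a :: s) v = reflection B a (word_act s v).
Proof. by []. Qed.

Lemma word_act_linear s : linear (word_act s).
Proof.
by elim: s => // a s IH k u v; rewrite !word_act_cons IH linearP.
Qed.

HB.instance Definition _ s :=
  GRing.isLinear.Build R V V _ (word_act s) (word_act_linear s).

Lemma word_act_cat s t v : word_act (s ++ t) v = word_act s (word_act t v).
Proof. exact: foldr_cat. Qed.

Lemma word_act_rcons s a v :
  word_act (rcons s a) v = word_act s (reflection B a v).
Proof. exact: foldr_rcons. Qed.

Lemma word_act_rconsK s a :
  B a a = 1 -> word_act (rcons (rcons s a) a) =1 word_act s.
Proof. by move=> a1 v; rewrite !word_act_rcons reflectionK. Qed.

Lemma word_act_revK s :
  {in s, forall a, B a a = 1} -> cancel (word_act (rev s)) (word_act s).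
Proof.
elim: s => // a s IH unit_as v.
rewrite rev_cons word_act_rcons word_act_cons IH.
  by rewrite reflectionK // unit_as ?mem_head.
by move=> b bs; rewrite unit_as // inE bs orbT.
Qed.

Lemma word_act_inj s : {in s, forall a, B a a = 1} -> injective (word_act s).
Proof.
move=> sU; apply: (can_inj (g := word_act (rev s))) => v.
rewrite -[X in word_act X v]revK word_act_revK // => a.
by rewrite mem_rev; apply: sU.
Qed.

(** ** Alternating words in two reflections *)

(** The alternating word of length [n] in [a] and [b] whose last letter, the
    first to act, is [b]: the one that can be a shortest word [s] such that
    appending [a] does not shorten it. *)
Fixpoint alt (n : nat) a b : seq V :=
  if n is n'.+1 then rcons (alt n' b a) b else [::].

Lemma all_alt (p : pred V) n a b : p a -> p b -> all p (alt n a b).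
Proof. by elim: n a b => //= n IH a b pa pb; rewrite all_rcons pb IH. Qed.

Lemma size_alt n a b : size (alt n a b) = n.
Proof. by elim: n a b => //= n IH a b; rewrite size_rcons IH. Qed.

Lemma alt_suffix m n a b : exists s,
  alt (m + n) a b = s ++ alt n a b /\ size s = m.
Proof.
elim: n a b => [|n IH] a b.
  by exists (alt m a b); rewrite cats0 addn0 size_alt.
by have [s [sE sm]] := IH b a; exists s; rewrite addnS /= sE rcons_cat.
Qed.

Lemma alt_fix n a b z : B a a = 1 -> B b b = 1 -> B a z = 0 -> B b z = 0 ->
  word_act (alt n a b) z = z.
Proof.
elim: n a b => //= n IH a b a1 b1 az bz; rewrite word_act_rcons.
by rewrite reflection_unitE // bz mulr0 scale0r subr0 IH.
Qed.

Lemma alt_root n a b (k : R) : B a a = 1 -> B b b = 1 -> B a b = - k ->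
  word_act (alt n a b) a =
  if odd n then cheb k n.+1 *: b + cheb k n *: a
           else cheb k n.+1 *: a + cheb k n *: b.
Proof.
suff [] : (forall a b, B a a = 1 -> B b b = 1 -> B a b = - k ->
    word_act (alt n a b) a = if odd n then cheb k n.+1 *: b + cheb k n *: a
           else cheb k n.+1 *: a + cheb k n *: b) /\
  (forall a b, B a a = 1 -> B b b = 1 -> B a b = - k ->
    word_act (alt n.+1 a b) a = if odd n.+1
           then cheb k n.+2 *: b + cheb k n.+1 *: a
           else cheb k n.+2 *: a + cheb k n.+1 *: b).
  by move=> + _; apply.
have refl_ba c d : B d d = 1 -> B c d = - k ->
    reflection B d c = c + (2 * k) *: d.
  by move=> d1 cd; rewrite reflection_unitE // Defs.formC cd mulrN scaleNr opprK.
elim: n => [|n [IH0 IH1]]; split=> // {}a {}b a1 b1 ab.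
- by rewrite /= /cheb /= scale1r scale0r addr0.
- by rewrite /= refl_ba // /cheb /= mulr1 subr0 scale1r addrC.
have ba : B b a = - k by rewrite Defs.formC.
(* The first letter to act only negates [a], which leaves a word shorter by two
   letters than the one of the goal. *)
have Ea : word_act (alt n.+1 b a) a = - word_act (alt n a b) a.
  by rewrite /= word_act_rcons reflection_self // linearN.
have -> : word_act (alt n.+2 a b) a =
    word_act (alt n.+1 b a) a + (2 * k) *: word_act (alt n.+1 b a) b.
  by rewrite [alt n.+2 _ _]/= word_act_rcons refl_ba // linearD linearZ.
rewrite Ea IH0 // IH1 // (chebSS k n.+1) (chebSS k n).
have comb (p q r c : R) (u v : V) :
    - (q *: u + p *: v) + c *: (r *: u + q *: v) =
    (c * r - q) *: u + (c * q - p) *: v.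
  rewrite opprD scalerDr !scalerA !scalerBl addrACA.
  by rewrite [- _ + _]addrC [X in _ + X]addrC.
by rewrite [odd n.+2]/= negbK [odd n.+1]/=; case: (odd n); rewrite /= comb.
Qed.

(** Both words fix the orthogonal of the plane of [a] and [b], and they agree
    on that plane because [cheb k m] vanishes; the plane has a complement as
    the form is nondegenerate on it. *)
Lemma braid_relation m a b : (2 <= m)%N -> B a a = 1 -> B b b = 1 ->
  B a b = - cos (pi / m%:R) -> word_act (alt m a b) =1 word_act (alt m b a).
Proof.
move=> m2 a1 b1 ab; set k := cos (pi / m%:R) in ab *.
have [cm cmS cmP] := cheb_cos_pi R m2.
have onplane c d : B c c = 1 -> B d d = 1 -> B c d = - k ->
    word_act (alt m c d) c = word_act (alt m d c) c.
  move=> c1 d1 cd; rewrite (alt_root m c1 d1 cd).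
  case: m m2 @k ab cd cm cmS cmP => // m m2 k ab cd cm cmS cmP.
  rewrite [alt _ d c]/= word_act_rcons reflection_self // linearN /=.
  rewrite (alt_root m c1 d1 cd) cm cmS cmP.
  by case: (odd m); rewrite /= !scale0r !addr0 ?add0r scale1r scaleN1r.
have k1 : 1 - k ^+ 2 != 0.
  rewrite -sin2cos2 expf_eq0 /= gt_eqF //; exact: sin_pi_div_gt0.
move=> v.
pose x := (B a v + k * B b v) / (1 - k ^+ 2).
pose y := (B b v + k * B a v) / (1 - k ^+ 2).
pose z := v - (x *: a + y *: b).
have ba : B b a = - k by rewrite Defs.formC.
have az : B a z = 0.
  by rewrite /z linearB linearD !linearZ /= a1 ab /x /y; field.
have bz : B b z = 0.
  by rewrite /z linearB linearD !linearZ /= b1 ba /x /y; field.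
have vE : v = z + (x *: a + y *: b) by rewrite /z subrK.
clearbody z; rewrite vE !linearD !linearZ /= (alt_fix m a1 b1 az bz).
by rewrite (alt_fix m b1 a1 bz az) (onplane a b) // -(onplane b a).
Qed.

(** ** Shortest words and the sign of roots *)

Variable Delta : {fset V}.
Hypothesis simpleD : simple_system B Delta.

Lemma simple_unit : {in Delta, forall a, B a a = 1}.
Proof. by case: simpleD. Qed.

Definition length_ge (f : V -> V) (n : nat) : Prop :=
  forall t, all [in Delta] t -> word_act t =1 f -> (n <= size t)%N.

Definition shortest s : Prop := length_ge (word_act s) (size s).

(** By parity of the length, this is the usual condition that [rcons s a] is
    longer than [s] in the group; the weak form spares the parity argument. *)
Definition ascent s a : Prop := length_ge (word_act (rcons s a)) (size s).

Lemma shortest_alt s a b : a \in Delta -> b \in Delta ->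
  all (pred2 a b) s -> shortest s -> ascent s a -> s = alt (size s) a b.
Proof.
elim/last_ind: s a b => // s c IH a b aD bD.
rewrite all_rcons => /andP[/orP[] /eqP-> sab] sh asc.
  have sD : all [in Delta] s.
    by apply: sub_all sab => d /orP[] /eqP->.
  have := asc s sD (fsym (word_act_rconsK _ (simple_unit aD))).
  by rewrite size_rcons ltnn.
rewrite size_rcons /= -(IH b a) //.
- by apply: sub_all sab => d; rewrite /= orbC.
- move=> t tD ts; have := sh (rcons t b); rewrite !size_rcons all_rcons bD tD.
  by apply=> // v; rewrite !word_act_rcons ts.
- by move=> t tD ts; apply: ltnW; rewrite -(size_rcons s b); apply: sh.
Qed.

(** When the product of the two reflections has finite order [m], the braid
    relation forces the alternating word to have fewer than [m] letters:
    otherwise its last [m] letters could be rewritten to end in [a], against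
    [ascent s a]. *)
Lemma dihedral_root_nonneg s a b : a \in Delta -> b \in Delta -> a != b ->
  all (pred2 a b) s -> shortest s -> ascent s a ->
  exists x y : R, [/\ 0 <= x, 0 <= y & word_act s a = x *: a + y *: b].
Proof.
move=> aD bD neq_ab sab sh asc; have a1 := simple_unit aD.
have b1 := simple_unit bD; have sE := shortest_alt aD bD sab sh asc.
set n := size s in sE.
suff [c0 c1] : 0 <= cheb (- B a b) n /\ 0 <= cheb (- B a b) n.+1.
  rewrite sE (alt_root n a1 b1 (esym (opprK _))).
  case: (odd n); last by exists (cheb (- B a b) n.+1), (cheb (- B a b) n).
  by exists (cheb (- B a b) n), (cheb (- B a b) n.+1); rewrite addrC.
case: simpleD => _ /(_ a b aD bD neq_ab) [abN1|[m m2 abE]] _.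
  by split; apply: cheb_ge0; rewrite lerNr.
suff nm : (n < m)%N.
  by rewrite abE opprK; split; apply: cheb_cos_pi_ge0 => //; lia.
rewrite ltnNge; apply/negP => mn.
have [u [uE su]] := alt_suffix (n - m) m a b.
rewrite subnK // -sE in uE.
have uD : all [in Delta] u.
  have : all [in Delta] s by rewrite sE all_alt.
  by rewrite uE all_cat => /andP[].
case: m m2 abE mn uE su => // m m2 abE mn uE su.
have := asc (u ++ alt m a b); rewrite all_cat uD all_alt // size_cat size_alt.
rewrite su -/n => /(_ isT) le_n.
suff /le_n : word_act (u ++ alt m a b) =1 word_act (rcons s a) by lia.
move=> v; rewrite word_act_rcons uE !word_act_cat (braid_relation m2 a1 b1 abE).
by rewrite [alt m.+1 b a]/= word_act_rcons reflectionK.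
Qed.

Definition nonneg v : Prop := forall i, 0 <= coord (in_tuple Delta) i v.

Lemma nonneg_comb x y u v :
  0 <= x -> 0 <= y -> nonneg u -> nonneg v -> nonneg (x *: u + y *: v).
Proof.
move=> x0 y0 u0 v0 i; rewrite linearP linearZ /=.
by rewrite addr_ge0 ?mulr_ge0.
Qed.

Hypothesis basisD : basis_of fullv Delta.

Lemma simple_nonneg a : a \in Delta -> nonneg a.
Proof.
move=> aD i; have /tnthP[j ->] : a \in in_tuple Delta by [].
by rewrite (tnth_nth 0) coord_free ?ler0n // (basis_free basisD).
Qed.

(** Split off from [s] the longest possible tail in the parabolic subgroup
    of [a] and of the last letter [b] of [s], leaving a head [v]. By
    minimality, [v] is shortest and both [a] and [b] are ascents of [v], so
    induction applies to [v]; the tail sends [a] to a nonnegative combination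
    of [a] and [b] by the dihedral case. *)
Lemma ascent_nonneg s a : all [in Delta] s -> a \in Delta ->
  shortest s -> ascent s a -> nonneg (word_act s a).
Proof.
have [n] := ubnP (size s); elim: n s a => // n IH s a sn sD aD sh asc.
have a1 := simple_unit aD.
case/lastP: s sn sD sh asc => [|s' b] sn sD sh asc; first exact: simple_nonneg.
set s := rcons s' b in sn sD sh asc *.
have /andP[bD s'D] : (b \in Delta) && all [in Delta] s'.
  by move: sD; rewrite /s all_rcons.
have b1 := simple_unit bD.
have neq_ab : a != b.
  apply/eqP => ab; have := asc s' s'D; rewrite /s ab size_rcons ltnn.
  by move=> /(_ (fsym (word_act_rconsK _ b1))).
pose split_at i := `[< exists p q, [/\ all [in Delta] p, all (pred2 a b) q,
  word_act (p ++ q) =1 word_act s, (size p + size q <= size s)%N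
  & size p = i] >].
have split_s' : split_at (size s').
  apply/asboolP; exists s', [:: b].
  by split; rewrite //= ?eqxx ?orbT // /s ?cats1 // size_rcons addn1.
have ex_split : exists i, split_at i by exists (size s').
case: (ex_minnP ex_split) => i /asboolP[v [u [vD uab vuE le_vu vi]]] min_i.
have uD : all [in Delta] u by apply: sub_all uab => d /orP[] /eqP->.
have lt_vs : (size v < size s)%N by rewrite vi /s size_rcons ltnS min_i.
have sh_v : shortest v.
  move=> t tD tv; have := sh (t ++ u); rewrite all_cat tD uD size_cat.
  move=> /(_ isT) le_s; suff /le_s : word_act (t ++ u) =1 word_act s.
    by move/(leq_trans le_vu); rewrite leq_add2r.
  by move=> x; rewrite -vuE !word_act_cat tv.
have asc_v c : (c == a) || (c == b) -> ascent v c.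
  move=> cab t tD tv; rewrite vi leqNgt; apply/negP => lt_t.
  have c1 : B c c = 1 by case/orP: cab => /eqP->.
  have: split_at (size t).
    apply/asboolP; exists t, (c :: u); split; rewrite //= ?cab //; last first.
      by rewrite addnS -addSn; apply: leq_trans le_vu; rewrite leq_add2r vi.
    move=> x; rewrite -vuE !word_act_cat tv word_act_rcons word_act_cons.
    by rewrite reflectionK.
  by move/min_i; rewrite leqNgt lt_t.
have sh_u : shortest u.
  move=> t tD tu; have := sh (v ++ t); rewrite all_cat vD tD size_cat.
  move=> /(_ isT) le_s; suff /le_s : word_act (v ++ t) =1 word_act s.
    by move/(leq_trans le_vu); rewrite leq_add2l.
  by move=> x; rewrite -vuE !word_act_cat tu.
have asc_u : ascent u a.
  move=> t tD tu; have := asc (v ++ t); rewrite all_cat vD tD size_cat.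
  move=> /(_ isT) le_s.
  suff /le_s : word_act (v ++ t) =1 word_act (rcons s a).
    by move/(leq_trans le_vu); rewrite leq_add2l.
  by move=> x; rewrite word_act_rcons -vuE !word_act_cat tu word_act_rcons.
have [x [y [x0 y0 uE]]] := dihedral_root_nonneg aD bD neq_ab uab sh_u asc_u.
rewrite -vuE word_act_cat uE linearD !linearZ /=.
have lt_vn : (size v < n)%N by apply: leq_trans lt_vs sn.
by apply: nonneg_comb => //; apply: IH => //; apply: asc_v; rewrite eqxx ?orbT.
Qed.

Lemma shortest_word s : all [in Delta] s ->
  exists t, [/\ all [in Delta] t, word_act t =1 word_act s & shortest t].
Proof.
move=> sD; pose len i :=
  `[< exists t, [/\ all [in Delta] t, word_act t =1 word_act s & size t = i] >].
have ex_len : exists i, len i by exists (size s); apply/asboolP; exists s.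
case: (ex_minnP ex_len) => i /asboolP[t [tD ts ti]] min_i.
exists t; split=> // r rD rt; rewrite ti; apply: min_i; apply/asboolP.
by exists r; split=> // v; rewrite rt.
Qed.

(** If [a] is not an ascent of a shortest word [s], a shorter word [t] for
    [rcons s a] has [a] as an ascent and sends [a] to the opposite root. *)
Lemma root_sign s a : all [in Delta] s -> a \in Delta ->
  nonneg (word_act s a) \/ nonneg (- word_act s a).
Proof.
move=> sD aD; have a1 := simple_unit aD.
have [{sD}r [rD <- sh]] := shortest_word sD.
have [asc|] := pselect (ascent r a); first by left; apply: ascent_nonneg.
move=> /existsNP[q /not_implyP[qD /not_implyP[qra /negP]]].
rewrite -ltnNge => lt_q.
have [t [tD tq sh_t]] := shortest_word qD.
right; have -> : - word_act r a = word_act t a.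
  by rewrite tq qra word_act_rcons reflection_self // linearN.
apply: ascent_nonneg => // w wD wta.
have /(sh w wD) : word_act w =1 word_act r.
  by move=> v; rewrite wta word_act_rcons tq qra word_act_rcons reflectionK.
by apply: leq_trans (leq_trans (sh_t q qD (fsym tq)) (ltnW lt_q)).
Qed.

(** * The reflection group, its roots and the sum of coordinates *)

Lemma reflection_group_word w : reflection_group B Delta w ->
  exists2 s, all [in Delta] s & w =1 word_act s.
Proof.
move/(_ [set f | orthogonal_group B f /\
                 exists2 s, all [in Delta] s & f =1 word_act s]).
case=> //; split.
  have unitD s : all [in Delta] s -> {in s, forall a, B a a = 1}.
    by move=> sD a /(allP sD); apply: simple_unit.
  split.
  - by move=> f [].
  - split; last by exists [::] => // v; rewrite id_lfunE.
    by split; [apply/lker0P => u v; rewrite !id_lfunE|move=> u v; rewrite !id_lfunE].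
  - move=> f g [[f0 fB] [s sD fs]] [[g0 gB] [t tD gt]]; split.
      split; last by move=> u v; rewrite !comp_lfunE fB gB.
      by apply/lker0P => u v; rewrite !comp_lfunE => /(lker0P f0) /(lker0P g0).
    exists (s ++ t); first by rewrite all_cat sD tD.
    by move=> v; rewrite comp_lfunE fs gt word_act_cat.
  - move=> f [[f0 fB] [s sD fs]].
    have fVK v : f ((f^-1)%VF v) = v.
      by rewrite -[v](word_act_revK (unitD s sD)) -fs lker0_lfunK.
    split; last first.
      exists (rev s); first by rewrite all_rev.
      move=> v; apply: (lker0P f0).
      by rewrite fVK fs word_act_revK //; apply: unitD.
    split; last by move=> u v; rewrite -fB !fVK.
    by apply/lker0P => u v /(congr1 f); rewrite !fVK.
move=> _ [a aD <-]; split; last by exists [:: a]; rewrite //= andbT.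
by apply: reflection_orthogonal; rewrite simple_unit // oner_neq0.
Qed.

Lemma reflection_group_closed : orthogonal_subgroup B (reflection_group B Delta).
Proof.
split=> [f Wf|M []|f g Wf Wg M CM|f Wf M CM].
- have [s sD fs] := reflection_group_word Wf.
  have sU : {in s, forall a, B a a = 1}.
    by move=> a /(allP sD); apply: simple_unit.
  split.
    by apply/lker0P => u v; rewrite !fs; apply: word_act_inj.
  move=> u v; rewrite !fs; elim: s {fs sD} sU => // a s IH sU.
  rewrite !word_act_cons reflection_form; last by rewrite sU ?mem_head.
  by apply: IH => b bs; rewrite sU // inE bs orbT.
- by case.
- by case: (CM) => -[_ _ MM _] _; apply: MM; [apply: Wf|apply: Wg].
- by case: (CM) => -[_ _ _ MV] _; apply: MV; apply: Wf.
Qed.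

Lemma reflection_group_inj w : reflection_group B Delta w -> injective w.
Proof.
by case: reflection_group_closed => WO _ _ _ /WO[w0 _]; apply/lker0P.
Qed.

Lemma reflection_group_form w u v :
  reflection_group B Delta w -> B (w u) (w v) = B u v.
Proof. by case: reflection_group_closed => WO _ _ _ /WO[_ ->]. Qed.

Definition roots : set V :=
  [set w a | w in reflection_group B Delta & a in [set` Delta]].

Lemma root_form r : roots r -> B r r = 1.
Proof. by case=> w Ww [a aD <-]; rewrite reflection_group_form // simple_unit. Qed.

Lemma root_act w r : reflection_group B Delta w -> roots r -> roots (w r).
Proof.
case: reflection_group_closed => _ _ WM _.
move=> Ww [f Wf [a aD <-]]; exists (w \o f)%VF; first exact: WM.
by exists a => //; rewrite comp_lfunE.
Qed.

Lemma root_reflection r : roots r -> reflection_group B Delta (reflection B r).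
Proof.
case: reflection_group_closed => WO _ WM WV rr.
have r1 := root_form rr; case: rr => w Ww [a aD wa].
have [/lker0_lfunVK wK _] := WO _ Ww.
have wVK v : w ((w^-1)%VF v) = v.
  have [s sD ws] := reflection_group_word Ww.
  have sU : {in s, forall b, B b b = 1}.
    by move=> b /(allP sD); apply: simple_unit.
  by rewrite -[v](word_act_revK sU) -ws lker0_lfunK //; case: (WO _ Ww).
have -> : reflection B r = (w \o (reflection B a \o w^-1))%VF.
  apply/lfunP => v; rewrite !comp_lfunE !reflection_unitE ?(simple_unit aD) //.
  rewrite linearB [X in _ = _ - X]linearZ /= wVK wa; congr (_ - (2 * _) *: _).
  by rewrite -[in LHS](wVK v) -wa reflection_group_form.
have Wa : reflection_group B Delta (reflection B a).
  by move=> M [_]; apply; exists a.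
exact: WM _ _ Ww (WM _ _ Wa (WV _ Ww)).
Qed.

Lemma root_opp r : roots r -> roots (- r).
Proof.
move=> rr; rewrite -reflection_self ?root_form //.
by apply: root_act => //; apply: root_reflection.
Qed.

Definition signed v : Prop := nonneg v \/ nonneg (- v).

Lemma root_signed r : roots r -> signed r.
Proof.
case=> w Ww [a aD <-]; have [s sD ws] := reflection_group_word Ww.
by rewrite ws; apply: root_sign.
Qed.

Lemma signedZ (c : R) v : signed v -> signed (c *: v).
Proof.
have posZ d u : 0 <= d -> nonneg u -> nonneg (d *: u).
  by move=> d0 u0 i; rewrite linearZ /= mulr_ge0.
case: (leP 0 c) => [c0|/ltW c0] [v0|v0].
- by left; apply: posZ.
- by right; rewrite -scalerN; apply: posZ.
- by right; rewrite -scaleNr; apply: posZ => //; rewrite oppr_ge0.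
- by left; rewrite -[c *: v]opprK -scaleNr -scalerN; apply: posZ => //;
    rewrite oppr_ge0.
Qed.

Lemma norm1_linear : linear (norm1 Delta : V -> R^o).
Proof.
move=> k u v; rewrite /norm1 scaler_sumr -big_split /=.
by apply: eq_bigr => i _; rewrite linearP.
Qed.

HB.instance Definition _ :=
  GRing.isLinear.Build R V R^o _ (norm1 Delta : V -> R^o) norm1_linear.

Lemma norm1Z k v : norm1 Delta (k *: v) = k * norm1 Delta v.
Proof. exact: linearZ. Qed.

Lemma norm1_signed v : signed v -> v != 0 -> norm1 Delta v != 0.
Proof.
have pos u : nonneg u -> norm1 Delta u = 0 -> u = 0.
  move=> u0 /eqP; rewrite psumr_eq0; last by move=> i _; apply: u0.
  move=> /allP uz; rewrite (coord_basis (X := in_tuple Delta) basisD (memvf u)).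
  rewrite big1 // => i _.
  by rewrite (eqP (uz i _)) ?scale0r // mem_index_enum.
move=> [v0|v0]; apply: contra_neq; first exact: pos.
move=> vz; apply: oppr_inj; rewrite oppr0; apply: pos => //.
by rewrite linearN /= vz oppr0.
Qed.

Lemma root_norm1 r : roots r -> norm1 Delta r != 0.
Proof.
move=> rr; apply: norm1_signed; first exact: root_signed.
by apply: contra_eq_neq (root_form rr) => ->; rewrite linear0l eq_sym oner_neq0.
Qed.

(** * Isotropic vectors in the plane of two roots *)

(** The isotropic direction [u *: r1 + r2] attracts the orbit of [r1] under the
    dihedral group of [r1] and [r2]: the product of the two reflections turns
    the weight [p] of that direction into [p * u ^+ 2 + 2 * k * e], and the
    weight [e] left on [r1] into [e / u ^+ 2]. As [2 * k = u + u^-1] is at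
    least [1], the ratio [p / e] grows by at least [1], even when [u = 1]. *)
Lemma roots_near_isotropic r1 r2 (k u : R) n : roots r1 -> roots r2 ->
  B r1 r2 = - k -> 1 <= u -> u ^+ 2 + 1 = 2 * u * k ->
  exists e p : R,
    [/\ 0 < e, n%:R * e <= p & roots (e *: r1 + p *: (u *: r1 + r2))].
Proof.
move=> rr1 rr2 r12 u1 uk; have u0 : 0 < u by lra.
have kE : k = (u ^+ 2 + 1) / (2 * u) by rewrite uk; field; rewrite gt_eqF.
have refl1 x y : reflection B r1 (x *: r1 + y *: r2) =
    (2 * k * y - x) *: r1 + y *: r2.
  rewrite linearD !linearZ /= reflection_self ?root_form //.
  rewrite reflection_unitE ?root_form // r12 mulrN scaleNr opprK scalerDr scalerN.
  rewrite scalerA scalerBl [y * _]mulrC addrCA [RHS]addrC.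
  by congr (_ + _); rewrite addrC.
have refl2 x y : reflection B r2 (x *: r1 + y *: r2) =
    x *: r1 + (2 * k * x - y) *: r2.
  rewrite linearD !linearZ /= reflection_self ?root_form //.
  rewrite reflection_unitE ?root_form // Defs.formC r12 mulrN scaleNr opprK.
  by rewrite scalerDr scalerN scalerA scalerBl [x * _]mulrC addrA.
have lin x y : x *: r1 + y *: (u *: r1 + r2) = (x + y * u) *: r1 + y *: r2.
  by rewrite scalerDr scalerA scalerDl addrA.
elim: n => [|n [e [p [e0 nep rep]]]].
  by exists 1, 0; split; rewrite ?ltr01 ?mul0r // scale1r scale0r addr0.
exists (e / u ^+ 2), (p * u ^+ 2 + 2 * k * e).
have uu1 : 1 <= u ^+ 2 by rewrite expr2; nra.
have le_eu : e / u ^+ 2 <= e by rewrite ler_pdivrMr; nra.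
split; first by rewrite divr_gt0 // exprn_gt0.
  have ke : e <= 2 * k * e.
    have -> : 2 * k = u + u^-1 by rewrite kE; field; rewrite gt_eqF.
    have := invr_gt0 u; rewrite u0; nra.
  have p0 : 0 <= p by apply: le_trans nep; rewrite mulr_ge0 ?ler0n ?ltW.
  have n0 : (0 : R) <= n%:R by rewrite ler0n.
  have : n%:R * (e / u ^+ 2) <= n%:R * e by rewrite ler_wpM2l.
  rewrite -[n.+1]addn1 natrD; nra.
have := root_act (root_reflection rr1) (root_act (root_reflection rr2) rep).
rewrite !lin refl2 refl1; congr roots; congr (_ *: _ + _ *: _).
  by rewrite kE; field; rewrite gt_eqF.
by rewrite kE; field; rewrite gt_eqF.
Qed.

(** If [y := u *: r1 + r2] had coordinates of both signs, so would the roots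
    close enough to the direction of [y]. *)
Lemma isotropic_signed_ge1 r1 r2 (k u : R) : roots r1 -> roots r2 ->
  B r1 r2 = - k -> 1 <= u -> u ^+ 2 + 1 = 2 * u * k ->
  signed (u *: r1 + r2).
Proof.
move=> rr1 rr2 r12 u1 uk; set y := u *: r1 + r2; apply: contrapT.
pose c i (v : V) := coord (in_tuple Delta) i v.
move=> /not_orP[/existsNP[i /negP]]; rewrite -ltNge -/(c i y) => yi.
move=> /existsNP[j /negP]; rewrite linearN -ltNge /= oppr_lt0 -/(c j y) => yj.
have [n [ni nj]] : exists n : nat, c i r1 < n%:R * - c i y /\
                                   - c j r1 < n%:R * c j y.
  pose M := `|c i r1| / - c i y + `|c j r1| / c j y.
  have Mi0 : 0 <= `|c i r1| / - c i y by rewrite divr_ge0 // oppr_ge0 ltW.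
  have Mj0 : 0 <= `|c j r1| / c j y by rewrite divr_ge0 // ltW.
  have /archi_boundP Mn : 0 <= M by rewrite addr_ge0.
  exists (Num.bound M); split.
    apply: le_lt_trans (ler_norm _) _.
    by rewrite -ltr_pdivrMr ?oppr_gt0 //; apply: le_lt_trans Mn; rewrite lerDl.
  apply: le_lt_trans (ler_norm _) _; rewrite normrN.
  by rewrite -ltr_pdivrMr //; apply: le_lt_trans Mn; rewrite lerDr.
have [e [p [e0 nep rep]]] := roots_near_isotropic n rr1 rr2 r12 u1 uk.
have cE l : coord (in_tuple Delta) l (e *: r1 + p *: y) = e * c l r1 + p * c l y.
  by rewrite linearD !linearZ.
case: (root_signed rep) => [/(_ i)|/(_ j)]; rewrite ?linearN /= cE; nra.
Qed.

(** When [q] is nonzero, isotropy says that the ratio [u] of [p] to [q]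
    satisfies [u ^+ 2 + 1 = 2 * u * k]; exchanging the two roots and changing
    the sign of one of them gives [1 <= u]. *)
Lemma isotropic_signed r1 r2 (p q : R) : roots r1 -> roots r2 ->
  B (p *: r1 + q *: r2) (p *: r1 + q *: r2) = 0 -> signed (p *: r1 + q *: r2).
Proof.
wlog le_qp : p q r1 r2 / `|q| <= `|p|.
  move=> main rr1 rr2; case: (leP `|q| `|p|) => [|/ltW] le_pq.
    exact: main.
  by rewrite addrC; apply: main.
move=> rr1 rr2; set x := _ + _ => xx.
have [q0|q0] := eqVneq q 0.
  by rewrite /x q0 scale0r addr0; apply: signedZ; apply: root_signed.
pose k : R := - B r1 r2; pose u := p / q.
have pE : p = q * u by rewrite /u mulrCA divff // mulr1.
have u1 : 1 <= `|u| by rewrite normf_div ler_pdivlMr ?normr_gt0 // mul1r.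
have uE : u ^+ 2 + 1 = 2 * u * k.
  move: xx; rewrite /x linearDr !linearDl /= !linearZr !linearZl /=.
  rewrite !root_form // (Defs.formC B r2) pE => xx.
  by apply: (mulfI (expf_neq0 2 q0)); rewrite /k; move: xx; lra.
have -> : x = q *: (u *: r1 + r2) by rewrite /x scalerDr scalerA -pE.
apply: signedZ; case: (ger0P u) u1 => u0 u1.
  by apply: (isotropic_signed_ge1 (k := k)) => //; rewrite /k opprK.
rewrite -[u *: r1]opprK -scaleNr -scalerN.
apply: (isotropic_signed_ge1 (k := - k)) => //; first exact: root_opp.
  by rewrite linearNl /= /k opprK.
by rewrite sqrrN uE; ring.
Qed.

End Words.

(** * Lines, the isotropic cone and the action *)

Theorem proposition3p5 (R : realType) (V : vectType R) (B : {symmetric V})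
    (Phi : set V) (Delta : {fset V})
    (rootsPhi : based_root_system B Phi Delta)
    (infPhi : infinite_set Phi)
    (basisDelta : basis_of fullv Delta) :
  (forall rho x : V, Phi rho -> action_domain B Delta x -> isotropic_cone B x ->
     (B rho x = 0 ->
        line (normalize Delta rho) x `&` isotropic_cone B = [set x] /\
        act Delta (reflection B rho) x = x) /\
     (B rho x <> 0 ->
        line (normalize Delta rho) x `&` isotropic_cone B =
          [set x; act Delta (reflection B rho) x] /\
        x <> act Delta (reflection B rho) x)) /\
  (forall (rho1 rho2 x : V) (w : 'End(V)),
     Phi rho1 -> Phi rho2 -> rho1 <> rho2 ->
     (line (normalize Delta rho1) (normalize Delta rho2) `&` isotropic_cone B) x ->
     reflection_group B Delta w ->
     (line (act Delta w (normalize Delta rho1))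
           (act Delta w (normalize Delta rho2)) `&` isotropic_cone B)
       (act Delta w x)).
Proof.
case: rootsPhi infPhi => simpleD -> _; split.
  move=> rho x rr [x1 xD] xx.
  have n0 := root_norm1 simpleD basisDelta rr.
  have r1 := root_form simpleD rr.
  set n := norm1 Delta rho in n0.
  have sE : reflection B rho x = x - (2 * B rho x) *: rho.
    exact: reflection_unitE.
  have lineB l : B (l *: normalize Delta rho + (1 - l) *: x)
                   (l *: normalize Delta rho + (1 - l) *: x) =
                 l / n * (l / n + 2 * (1 - l) * B rho x).
    rewrite /normalize -/n linearDr !linearDl /= !linearZr !linearZl /=.
    rewrite r1 (Defs.formC B x rho) (xx : B x x = 0); ring.
  have line_x : (line (normalize Delta rho) x `&` isotropic_cone B) x.
    by split=> //; exists 0 => //; rewrite scale0r add0r subr0 scale1r.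
  split=> [rx0|rx0].
    split; last first.
      by rewrite /act sE rx0 mulr0 scale0r subr0 /normalize x1 invr1 scale1r.
    apply/seteqP; split=> [y [[l _ <-]]|y -> //].
    rewrite /isotropic_cone /= lineB rx0 mulr0 addr0 -expr2 => /eqP.
    rewrite sqrf_eq0 mulf_eq0 invr_eq0 (negPf n0) orbF => /eqP ->.
    by rewrite scale0r add0r subr0 scale1r.
  set b := B rho x in sE lineB rx0; have b0 : b != 0 by apply/eqP.
  have nsE : norm1 Delta (reflection B rho x) = 1 - 2 * b * n.
    by rewrite sE linearB /= norm1Z x1.
  have ns0 : 1 - 2 * b * n != 0.
    apply/eqP => nsx; apply: xD; exists (reflection B rho).
      exact: (root_reflection simpleD rr).
    exists (reflection B rho x); last by rewrite reflectionK.
    exact: etrans nsE nsx.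
  (* [t] is the nonzero root in [l] of [lineB]. *)
  pose t := - (2 * b * n) / (1 - 2 * b * n).
  have actE : act Delta (reflection B rho) x =
              t *: normalize Delta rho + (1 - t) *: x.
    rewrite /act {1}/normalize nsE sE /normalize -/n scalerBr !scalerA addrC.
    rewrite -scaleNr.
    by congr (_ *: _ + _ *: _); rewrite /t; field; rewrite ?n0 ?ns0.
  split.
    apply/seteqP; split=> [y [[l _ <-]]|y [->|->] //].
      rewrite /isotropic_cone /= lineB => /eqP; rewrite !mulf_eq0 invr_eq0.
      rewrite (negPf n0) orbF => /orP[/eqP ->|/eqP lE].
        by left; rewrite scale0r add0r subr0 scale1r.
      right; rewrite actE; suff -> : l = t by [].
      have {}lE : l * (1 - 2 * b * n) = - (2 * b * n).
        have : n * (l / n + 2 * (1 - l) * b) = 0 by rewrite lE mulr0.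
        by rewrite mulrDr mulrCA divff // mulr1; lra.
      by apply: (mulIf ns0); rewrite lE /t divfK.
    rewrite actE; split; first by exists t.
    rewrite /isotropic_cone /= lineB /t; field; by rewrite ?n0 ?ns0.
  rewrite actE => xE.
  have t0 : t != 0.
    by rewrite /t mulf_neq0 ?oppr_eq0 ?invr_eq0 ?mulf_neq0 ?pnatr_eq0.
  have xr : normalize Delta rho = x.
    apply: (scalerI t0); rewrite -[LHS](addrK ((1 - t) *: x)) -xE.
    by rewrite -{1}[x]scale1r -scalerBl opprB addrC subrK.
  (* At [l = 1], [lineB] is the form at the normalized root, which is not
     isotropic. *)
  have := lineB 1; rewrite subrr scale0r addr0 scale1r xr (xx : B x x = 0).
  move/esym/eqP; rewrite mulr0 mul0r addr0 mul1r mulf_eq0 invr_eq0 orbb.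
  by rewrite (negPf n0).
move=> rho1 rho2 x w rr1 rr2 _ [[l _ xE] xx] Ww.
have wr1 := root_act simpleD Ww rr1; have wr2 := root_act simpleD Ww rr2.
have n1 := root_norm1 simpleD basisDelta rr1.
have n2 := root_norm1 simpleD basisDelta rr2.
have m1 := root_norm1 simpleD basisDelta wr1.
have m2 := root_norm1 simpleD basisDelta wr2.
rewrite /act /normalize in xE *.
set N1 := norm1 Delta rho1 in xE n1 *; set N2 := norm1 Delta rho2 in xE n2 *.
set M1 := norm1 Delta (w rho1) in m1 *; set M2 := norm1 Delta (w rho2) in m2 *.
have wxE : w x = (l / N1) *: w rho1 + ((1 - l) / N2) *: w rho2.
  by rewrite -xE linearD !linearZ /= !scalerA.
have wxx : B (w x) (w x) = 0 by rewrite (reflection_group_form simpleD _ _ Ww).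
have x1 : norm1 Delta x = 1.
  by rewrite -xE linearD /= !norm1Z !mulVf // !mulr1 addrC subrK.
have x0 : x != 0.
  by apply: contra_eq_neq x1 => ->; rewrite linear0 eq_sym oner_neq0.
have wx0 : w x != 0.
  apply: contra_neq x0 => wx; apply: (reflection_group_inj simpleD Ww).
  by rewrite linear0.
have N0 : norm1 Delta (w x) != 0.
  apply: norm1_signed => //; rewrite wxE.
  by apply: (isotropic_signed simpleD basisDelta wr1 wr2); rewrite -wxE.
have NE : norm1 Delta (w x) = l * M1 / N1 + (1 - l) * M2 / N2.
  by rewrite wxE linearD /= !norm1Z -/M1 -/M2; ring.
set N := norm1 Delta (w x) in N0 NE *.
split; last by rewrite /isotropic_cone /= linearZr linearZl /= wxx !mulr0.
have wn1 : w (N1^-1 *: rho1) = N1^-1 *: w rho1 by rewrite linearZ.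
have wn2 : w (N2^-1 *: rho2) = N2^-1 *: w rho2 by rewrite linearZ.
rewrite wn1 wn2.
have nw1 : norm1 Delta (N1^-1 *: w rho1) = M1 / N1 by rewrite norm1Z mulrC.
have nw2 : norm1 Delta (N2^-1 *: w rho2) = M2 / N2 by rewrite norm1Z mulrC.
rewrite nw1 nw2.
exists (l * M1 / N1 / N) => //.
rewrite wxE scalerDr !scalerA; congr (_ *: _ + _ *: _).
  by field; rewrite m1 n1 N0.
have -> : 1 - l * M1 / N1 / N = (1 - l) * M2 / N2 / N.
  have -> : (1 - l) * M2 / N2 = N - l * M1 / N1 by rewrite NE; ring.
  by field; rewrite n1 N0.
by field; rewrite m2 n2 N0.
Qed.
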